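(* Let $x$ and $q$ be random variables with values in $\mathbb{R}^n$ and $\mathbb{R}^m$, with distributions $\mu_x$ and $\mu_q$, let $\mathcal{P}:\mathbb{R}^n\times\mathbb{R}^m\to\mathbb{R}$ be a polynomial and $l_1,u_1\in\mathbb{R}$, and let $\mathbf{P^*_{risk}}=\mathrm{Prob}_{\mu_x,\mu_q}\{l_1\le\mathcal{P}(x,q)\le u_1\}$. Define the real random variable $z=\mathcal{P}(x,q)$, and set $\mathcal{B}_z=[-1,1]$, $\mathcal{K}=[l_1,u_1]$, $\bar{\mathcal{K}}=\mathcal{B}_z\setminus[l_1,u_1]$. For $d\in\mathbb{N}$, let $\mathcal{P}_{\mathcal{K}},\mathcal{P}_{\bar{\mathcal{K}}}\in\mathbb{R}_d[z]$ be univariate polynomials such that, for $S=\mathcal{K}$ and $S=\bar{\mathcal{K}}$ respectively, $\mathcal{P}_S$ is an optimal solution of $$\min_{P\in\mathbb{R}_d[z]}\int_{\mathcal{B}_z}P(z)\,dz\quad\text{s.t. } P\ge 1\text{ on }S,\quad P\ge 0\text{ on }\mathcal{B}_z.$$ Write $\mathcal{P}_{\mathcal{K}}(z)=\sum_{i=0}^d c_{z_i}z^i=\sum_{i=0}^d c_{T_i}T_i(z)$ and $\mathcal{P}_{\bar{\mathcal{K}}}(z)=\sum_{i=0}^d\bar{c}_{z_i}z^i=\sum_{i=0}^d\bar{c}_{T_i}T_i(z)$ in the standard and Chebyshev bases. Then $$1-E[\mathcal{P}_{\bar{\mathcal{K}}}(z)]=1-\sum_{i=0}^d\bar{c}_{z_i}m^z_i\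 \le\ \mathbf{P^*_{risk}}\ \le\ E[\mathcal{P}_{\mathcal{K}}(z)]=\sum_{i=0}^d c_{z_i}m^z_i,$$ and, in the Chebyshev basis, $$1-\sum_{i=0}^d\bar{c}_{T_i}m^z_{T_i}\ \le\ \mathbf{P^*_{risk}}\ \le\ \sum_{i=0}^d c_{T_i}m^z_{T_i}.$$
   Context: $\mathbb{R}_d[z]$ is the set of real univariate polynomials of degree at most $d$. $T_i(z)=\cos(i\cos^{-1}z)$, $z\in[-1,1]$, is the Chebyshev polynomial of the first kind of degree $i$. Moments: $m^z_i=E[z^i]$ and $m^z_{T_i}=E[T_i(z)]$. The joint distribution of $(x,q)$ is the product $\mu_x\mu_q$. Standing assumptions: the set $\{(x,q)\in\mathbb{R}^n\times\mathbb{R}^m: l_1\le\mathcal{P}(x,q)\le u_1\}$ is compact and contained in $\mathcal{B}=[-1,1]^n\times[-1,1]^m$; $\mathrm{supp}(\mu_x)\subset[-1,1]^n$ and $\mathrm{supp}(\mu_q)\subset[-1,1]^m$; $-1\le\mathcal{P}(x,q)\le 1$ on $\mathcal{B}$ and $-1\le l_1,u_1\le 1$ (so that $z$ is supported on $[-1,1]$). *)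

(* Defs.v *)
From HB Require Import structures.
From mathcomp Require Import all_boot all_order all_algebra.
From mathcomp Require Import all_classical all_reals all_analysis.
From mathcomp Require Import ring.
(* Not imported: the notations of mpoly clash with those of mathcomp-analysis. *)
From mathcomp Require mpoly.

Set Implicit Arguments.
Unset Strict Implicit.
Unset Printing Implicit Defensive.

Import Order.TTheory GRing.Theory Num.Theory.
Import numFieldNormedType.Exports.
Local Open Scope classical_set_scope.
Local Open Scope ring_scope.

(* R^n with its Borel sigma-algebra; the carrier is 'rV[R]_n. *)
Notation borel_rV R n := (g_sigma_algebraType (@open 'rV[R]_n)).

Definition box (R : realType) (n : nat) : set 'rV[R]_n :=
  [set v | forall i, -1 <= v 0 i <= 1].
Arguments box : clear implicits.

(* The smallest closed set of full measure. *)
Definition msupport (R : realType) (n : nat)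
    (mu : set (borel_rV R n) -> \bar R) : set 'rV[R]_n :=
  \bigcap_(C in [set C : set 'rV[R]_n | closed C /\ mu (~` C) = 0%E]) C.

(* Value at (x, q) of a polynomial in n + m variables, the first n of which
   are the coordinates of x and the last m those of q. *)
Definition peval (R : realType) (n m : nat) (P : mpoly.mpoly (n + m) R)
    (y : 'rV[R]_n * 'rV[R]_m) : R :=
  mpoly.meval (fun i => row_mx y.1 y.2 0 i) P.

(* The polynomial that coincides with cos (i acos z) on [-1, 1]; the default
   value 0 is never used, by chebyshevTE. *)
Definition chebyshevT (R : realType) (i : nat) : {poly R} :=
  xget 0 [set p : {poly R} |
           forall z : R, -1 <= z <= 1 -> p.[z] = cos (i%:R * acos z)].

Arguments chebyshevT : clear implicits.

Lemma chebyshevT_exists (R : realType) (i : nat) : exists p : {poly R},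
  forall z : R, -1 <= z <= 1 -> p.[z] = cos (i%:R * acos z).
Proof.
suff [p [_ [pE _]]] : exists p q : {poly R},
    (forall z : R, -1 <= z <= 1 -> p.[z] = cos (i%:R * acos z)) /\
    (forall z : R, -1 <= z <= 1 -> q.[z] = cos (i.+1%:R * acos z)) by exists p.
elim: i => [|i [p [q [pE qE]]]].
  exists 1, 'X; split=> z z1; rewrite hornerE ?mul0r ?cos0// mul1r.
  by rewrite acosK// in_itv.
exists q, ('X * q *+ 2 - p); split=> // z z1.
rewrite !hornerE pE// qE//.
set a := acos z; have -> : z = cos a by rewrite /a acosK// in_itv.
have -> : i.+2%:R * a = i.+1%:R * a + a by rewrite -(natr1 i.+1); ring.
have -> : i%:R * a = i.+1%:R * a - a by rewrite -(natr1 i); ring.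
by rewrite cosB cosD; ring.
Qed.

Lemma chebyshevTE (R : realType) (i : nat) (z : R) : -1 <= z <= 1 ->
  (chebyshevT R i).[z] = cos (i%:R * acos z).
Proof.
move: z; rewrite /chebyshevT; case: xgetP => // /(_ _) H.
by have [p /H] := chebyshevT_exists R i.
Qed.

Definition feasible (R : realType) (d : nat) (S : set R) (p : {poly R}) : Prop :=
  [/\ (size p <= d.+1)%N,
      forall z : R, S z -> 1 <= p.[z] &
      forall z : R, -1 <= z <= 1 -> 0 <= p.[z]].

Definition optimal (R : realType) (d : nat) (S : set R) (p : {poly R}) : Prop :=
  feasible d S p /\ forall p', feasible d S p' ->
    (\int[lebesgue_measure]_(z in `[(-1)%R, 1%R]) (p.[z])%:E <=
     \int[lebesgue_measure]_(z in `[(-1)%R, 1%R]) (p'.[z])%:E)%E.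

(* Main.v *)
Require Import Defs.
From mathcomp Require Import all_boot all_order all_algebra.
From mathcomp Require Import all_classical all_reals all_analysis.
From mathcomp Require Import measurable_realfun.
From mathcomp Require mpoly.
Import Order.TTheory GRing.Theory Num.Theory.
Import numFieldNormedType.Exports.
Local Open Scope classical_set_scope.
Local Open Scope ring_scope.

(** The bounds come from one inequality. A polynomial [p] that is nonnegative
    on [-1, 1] and at least 1 on [S] dominates the indicator of [S] there, so
    for a random variable [z] with values in [-1, 1] the probability of any
    event forcing [z] into [S] is at most the expectation of [p.[z]]
    ([probability_le_expectation]). Taking [S = [l1, u1]] gives the upper
    bound on the risk; taking its complement in [-1, 1] bounds the probability
    of the complementary event, hence the risk from below. The formulas in
    terms of moments are linearity of the expectation in either basis
    ([expectation_horner_sum]).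

    What has to be checked is that [z = P (x, q)] is a random variable
    ([measurable_peval]) with values in [-1, 1] almost surely. The range of [P]
    is controlled only on the product of the boxes, and the hypotheses place
    the supports of the laws there, so one needs that a measure gives no mass
    to the complement of its support ([negligible_setC_msupport]). That is where
    second countability of R^n enters ([rational_ball_sub]). *)

Set Implicit Arguments.
Unset Strict Implicit.

(** The centre is a rational approximation [c] of [v] within [1 / k.+1]; if
    [2 / k.+1] is below the radius of a ball around [v] inside [U], the ball
    around [c] still lies in [U]. *)
Lemma rational_ball_sub (R : realType) (n : nat) (U : set 'rV[R]_n)
    (v : 'rV[R]_n) : open U -> U v ->
  exists (c : 'rV[rat]_n) (k : nat),
    ball (map_mx ratr c : 'rV[R]_n) k.+1%:R^-1 v /\
    ball (map_mx ratr c : 'rV[R]_n) k.+1%:R^-1 `<=` U.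
Proof.
move=> oU Uv; have /nbhs_ballP[e /= e0 eU] : nbhs v U by exact: open_nbhs_nbhs.
have [k /= ke] : exists k : nat, k.+1%:R^-1 < e / 2.
  have [|k] := @ltr_add_invr R 0 (e / 2); first exact: divr_gt0.
  by rewrite add0r; exists k.
have k0 : 0 < k.+1%:R^-1 :> R by rewrite invr_gt0.
have approx i : exists r : rat, ball (v 0 i) k.+1%:R^-1 (ratr r).
  have [|r] := @rat_in_itvoo R (v 0 i - k.+1%:R^-1) (v 0 i + k.+1%:R^-1).
    by rewrite ltrD2l gtrN.
  by rewrite in_itv => rv; exists r; rewrite -ball_normE /= ltr_distlC.
pose c : 'rV[rat]_n := \row_i projT1 (cid (approx i)).
have cv : ball v k.+1%:R^-1 (map_mx ratr c).
  split=> // i j; rewrite ord1 !mxE; exact: projT2 (cid (approx j)).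
exists c, k; split; first exact: ball_sym.
move=> w cw; apply: eU; rewrite (splitr e).
by apply: ball_triangle (le_ball (ltW ke) cv) (le_ball (ltW ke) cw).
Qed.

(** The complement of the support is a union of open null sets, possibly
    uncountable; each of its points lies in a rational ball contained in such a
    set, and there are only countably many rational balls. *)
Lemma negligible_setC_msupport (R : realType) (n : nat)
    (mu : {measure set (borel_rV R n) -> \bar R}) :
  mu.-negligible (~` msupport mu).
Proof.
pose B (c : 'rV[rat]_n * nat) : set 'rV[R]_n :=
  ball (map_mx ratr c.1 : 'rV[R]_n) c.2.+1%:R^-1.
(* The null rational balls, enumerated by their codes; the other codes
   contribute the empty set. *)
pose F (k : nat) : set (borel_rV R n) := if unpickle k is Some c then
  if `[< mu.-negligible (B c) >] then B c else set0 else set0.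
apply: (@negligibleS _ _ _ _ (\bigcup_k F k) _); last first.
  apply: negligible_bigcup => k; rewrite /F; case: unpickle => [c|].
    by case: ifPn => [/asboolP//|_]; exact: negligible_set0.
  exact: negligible_set0.
move=> v /existsNP[C /not_implyP[[cC C0] Cv]].
have oC : open (~` C) by exact: closed_openC.
have [c [k [cv cC']]] := rational_ball_sub oC Cv.
exists (pickle (c, k)) => //; rewrite /F pickleK ifT//; apply/asboolP.
by exists (~` C); split => //; exact: sub_sigma_algebra.
Qed.

Lemma ae_box (R : realType) (n : nat) (disp : measure_display)
    (T : measurableType disp) (Pr : probability T R)
    (x : {RV Pr >-> borel_rV R n}) :
  msupport (distribution Pr x) `<=` box R n ->
  {ae Pr, forall t, box R n (x t)}.
Proof.
move=> xbox.
have [N [mN N0 boxN]] :=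
  negligible_setC_msupport (distribution Pr x).
exists (x @^-1` N); split => //.
  by rewrite -[_ @^-1` _]setTI; exact: measurable_funPT.
by move=> t /= tbox; apply: boxN => /xbox.
Qed.

Lemma measurable_coord (R : realType) (n : nat) (i : 'I_n) :
  measurable_fun [set: borel_rV R n] (fun v : 'rV[R]_n => v 0 i).
Proof.
apply: (measurability _ (RGenOpens.measurableE R)).
move=> _ [_ [a [b ->]] <-]; rewrite setTI; apply: sub_sigma_algebra.
by apply: open_comp; [move=> v _|exact: interval_open]; exact: coord_continuous.
Qed.

Lemma measurable_peval (R : realType) (n m : nat) (P : mpoly.mpoly (n + m) R) :
  measurable_fun [set: borel_rV R n * borel_rV R m] (peval P).
Proof.
rewrite /peval; under eq_fun do rewrite mpoly.mevalE.
apply: measurable_sum => M; apply: measurable_funM => //.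
apply: measurable_prod => i _; apply: measurable_funX.
rewrite /row_mx; under eq_fun do rewrite mxE.
case: (fintype.split i) => j.
- exact: (measurableT_comp (@measurable_coord R n j) measurable_fst).
- exact: (measurableT_comp (@measurable_coord R m j) measurable_snd).
Qed.

Lemma measurable_horner (R : realType) (p : {poly R}) :
  measurable_fun [set: R] (horner p).
Proof.
have -> : horner p = fun w => \sum_(i < size p) p`_i * w ^+ i.
  by apply/funext => w; rewrite horner_coef.
by apply: measurable_sum => i; apply: measurable_funM.
Qed.

Section bounded_variable.
Context (R : realType) (disp : measure_display) (T : measurableType disp)
  (Pr : probability T R) (z : T -> R) (mz : measurable_fun [set: T] z)
  (z1 : {ae Pr, forall t, -1 <= z t <= 1}).

Let mpz p : measurable_fun [set: T] (fun t => p.[z t]).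
Proof. exact: measurableT_comp (measurable_horner p) mz. Qed.

(** On [-1, 1] the absolute value of [p] is at most the sum of those of its
    coefficients. The bound holds for [p.[z t]] only almost surely, which
    is enough for integrability. *)
Lemma integrable_horner (p : {poly R}) :
  Pr.-integrable setT (EFin \o (fun t => p.[z t])).
Proof.
apply/integrableP; split; first exact/measurable_EFinP.
pose M := \sum_(i < size p) `|p`_i|.
apply: (@le_lt_trans _ _ (\int[Pr]_(t in setT) (cst M%:E t))%E); last first.
  by rewrite integral_cst// [X in (_ * X)%E]probability_setT mule1 ltry.
apply: ae_ge0_le_integral => //.
- by apply: measurableT_comp => //; exact/measurable_EFinP.
- by move=> t _ /=; rewrite lee_fin sumr_ge0.
apply: filterS z1 => t zt _ /=; rewrite lee_fin horner_coef.
apply: (le_trans (ler_norm_sum _ _ _)); apply: ler_sum => i _.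
by rewrite normrM normrX ler_piMr// exprn_ile1// ler_norml.
Qed.

Lemma expectation_horner_sum (k : nat) (c : 'I_k -> R) (p : 'I_k -> {poly R}) :
  ('E_Pr[fun t => (\sum_(i < k) c i *: p i).[z t]] =
   \sum_(i < k) (c i)%:E * 'E_Pr[fun t => (p i).[z t]])%E.
Proof.
rewrite unlock.
under eq_integral do rewrite horner_sum -sumEFin.
rewrite (integral_sum measurableT); last by move=> i; exact: integrable_horner.
apply: eq_bigr => i _; rewrite -integralZl//; last exact: integrable_horner.
by apply: eq_integral => t _; rewrite hornerZ EFinM.
Qed.

(** The event [A] is separate from the preimage of [S] so that the inclusion is
    required only almost surely: the event that [z] avoids an interval is
    inside the preimage of its complement in [-1, 1] up to a null set. *)
Lemma probability_le_expectation (d : nat) (S : set R) (p : {poly R})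
    (A : set T) :
  measurable A -> feasible d S p -> {ae Pr, forall t, A t -> S (z t)} ->
  (Pr A <= 'E_Pr[fun t => p.[z t]])%E.
Proof.
move=> mA [_ p1 p0] AS; rewrite -(expectation_indic Pr mA).
(* Replacing [p] by its positive part changes nothing almost surely and gives
   the everywhere nonnegative integrand that monotonicity asks for. *)
have -> : ('E_Pr[fun t => p.[z t]] = 'E_Pr[fun t => Num.max 0%R p.[z t]])%E.
  rewrite unlock; apply: ae_eq_integral => //.
  - exact/measurable_EFinP.
  - by apply/measurable_EFinP; exact: measurable_maxr.
  by apply: filterS z1 => t /p0 pt _ /=; rewrite max_r.
apply: expectation_le => //.
- exact: measurable_maxr.
- by move=> t; rewrite le_max lexx.
apply: filterS AS => t AS; rewrite indicE le_max.
have [/set_mem /AS /p1 ->|_] := boolP (t \in _); first by rewrite orbT.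
by rewrite lexx.
Qed.

End bounded_variable.

Unset Implicit Arguments.
Set Strict Implicit.

Theorem mainTheorem2 (R : realType) (n m : nat)
  (disp : measure_display) (T : measurableType disp) (Pr : probability T R)
  (x : {RV Pr >-> borel_rV R n}) (q : {RV Pr >-> borel_rV R m})
  (P : mpoly.mpoly (n + m) R) (l1 u1 : R)
  (joint : forall A : set (borel_rV R n * borel_rV R m), measurable A ->
     pushforward Pr (fun t => (x t, q t)) A =
     (distribution Pr x \x distribution Pr q)%E A)
  (compact_set :
     compact [set y : 'rV[R]_n * 'rV[R]_m | l1 <= peval P y <= u1])
  (set_sub_B :
     [set y : 'rV[R]_n * 'rV[R]_m | l1 <= peval P y <= u1] `<=`
       box R n `*` box R m)
  (supp_x : msupport (distribution Pr x) `<=` box R n)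
  (supp_q : msupport (distribution Pr q) `<=` box R m)
  (P_range : forall y : 'rV[R]_n * 'rV[R]_m,
     (box R n `*` box R m) y -> -1 <= peval P y <= 1)
  (l1_ge : -1 <= l1) (u1_le : u1 <= 1)
  (d : nat) (PK PKbar : {poly R})
  (PK_opt : optimal d `[l1, u1] PK)
  (PKbar_opt : optimal d (`[-1, 1] `\` `[l1, u1]) PKbar)
  (c cbar cT cTbar : 'I_d.+1 -> R)
  (PK_std : PK = \sum_(i < d.+1) c i *: 'X^i)
  (PKbar_std : PKbar = \sum_(i < d.+1) cbar i *: 'X^i)
  (PK_cheb : PK = \sum_(i < d.+1) cT i *: chebyshevT R i)
  (PKbar_cheb : PKbar = \sum_(i < d.+1) cTbar i *: chebyshevT R i) :
  let z := fun t => peval P (x t, q t) in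
  let mz := fun i : nat => ('E_Pr[fun t => (z t ^+ i)%R])%E in
  let mT := fun i : nat => ('E_Pr[fun t => (chebyshevT R i).[z t]])%E in
  let risk := (distribution Pr x \x distribution Pr q)%E
                [set y : borel_rV R n * borel_rV R m | l1 <= peval P y <= u1] in
  ([/\ 1 - 'E_Pr[fun t => PKbar.[z t]] = 1 - \sum_(i < d.+1) (cbar i)%:E * mz i,
       1 - \sum_(i < d.+1) (cbar i)%:E * mz i <= risk,
       risk <= 'E_Pr[fun t => PK.[z t]] &
       'E_Pr[fun t => PK.[z t]] = \sum_(i < d.+1) (c i)%:E * mz i] /\
   (1 - \sum_(i < d.+1) (cTbar i)%:E * mT i <= risk /\
    risk <= \sum_(i < d.+1) (cT i)%:E * mT i))%E.
Proof.
move=> z mz mT risk.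
set K := [set y : borel_rV R n * borel_rV R m | l1 <= peval P y <= u1] in risk *.
have mzt : measurable_fun [set: T] z.
  apply: (measurableT_comp (measurable_peval P)).
  exact: measurable_fun_pair.
have z1 : {ae Pr, forall t, -1 <= z t <= 1}.
  by apply: filterS2 (ae_box supp_x) (ae_box supp_q) => t xt qt; exact: P_range.
have riskE : risk = Pr (z @^-1` `[l1, u1]).
  have -> : z @^-1` `[l1, u1] = (fun t => (x t, q t)) @^-1` K.
    by apply/seteqP; split => t /=; rewrite in_itv.
  rewrite /risk -joint//.
  rewrite (_ : K = peval P @^-1` `[l1, u1]).
    by rewrite -[_ @^-1` _]setTI; exact: measurable_peval.
  by apply/seteqP; split => t /=; rewrite in_itv.
have mzK : measurable (z @^-1` `[l1, u1]).
  by rewrite -[_ @^-1` _]setTI; exact: mzt.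
have upper : (risk <= 'E_Pr[fun t => PK.[z t]])%E.
  rewrite riskE; apply: (probability_le_expectation mzt z1 mzK PK_opt.1).
  exact: aeW.
have lower : (1 - 'E_Pr[fun t => PKbar.[z t]] <= risk)%E.
  rewrite leeBlDr; last first.
    by rewrite unlock; apply: integrable_fin_num => //; exact: integrable_horner.
  (* The claim is now [1 <= risk + E], and 1 splits as [risk] plus the
     probability that [z] avoids [l1, u1]. *)
  rewrite riskE -(probability_setT Pr) -(setvU (z @^-1` `[l1, u1])).
  rewrite measureU ?setICl//; last exact: measurableC.
  rewrite addeC leeD2l//.
  apply: (probability_le_expectation mzt z1 _ PKbar_opt.1).
    exact: measurableC.
  by apply: filterS z1 => t zt ztK; split => //=; rewrite in_itv.
have stdE p (a : 'I_d.+1 -> R) : p = \sum_(i < d.+1) a i *: 'X^i ->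
    ('E_Pr[fun t => p.[z t]] = \sum_(i < d.+1) (a i)%:E * mz i)%E.
  move=> ->; rewrite (expectation_horner_sum mzt z1); apply: eq_bigr => i _.
  by congr (_ * expectation _ _)%E; apply/funext => t; rewrite hornerXn.
split; first by rewrite -(stdE _ _ PK_std) -(stdE _ _ PKbar_std).
by rewrite -!(expectation_horner_sum mzt z1) -PK_cheb -PKbar_cheb.
Qed.
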